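(* Let $U$ be a unitary operator on a complex separable Hilbert space $\mathcal{H}$, and let $\mathcal{H}_{\mathbb{R}}$, $\mathfrak{C}(\mathcal{H}_{\mathbb{R}})$ and the real linear operators $U_r,U_c$ on $\mathcal{H}_{\mathbb{R}}$ be constructed from $U$ as described in the context. Then $U$ is unitarily equivalent to the operator $$\widehat{U}:=\begin{bmatrix} U_r & -U_c \\ U_c & U_r \end{bmatrix}$$ on $\mathfrak{C}(\mathcal{H}_{\mathbb{R}})$.
   Context: Let $U=\int_{\mathbb{T}}\xi\,dE(\xi)$ be the spectral representation of $U$, with spectral measure $E$ on the Borel sets $\mathcal{B}$ of $\mathbb{T}$. Fix an orthonormal (finite or infinite) sequence $(\mathbf{x}_k)_{k\ge1}$ in $\mathcal{H}$ such that $\mathcal{H}=\bigoplus_{k\ge1}\mathcal{H}(\mathbf{x}_k)$ (orthogonal sum), where $\mathcal{H}(\mathbf{x}_k)$ is the closed complex linear span of $\{E(\Omega)\mathbf{x}_k:\Omega\in\mathcal{B}\}$ (such a sequence always exists). Let $\mathcal{H}(\mathbf{x}_k)_{\mathbb{R}}$ be the closed real linear span of $\{E(\Omega)\mathbf{x}_k:\Omega\in\mathcal{B}\}$ and $\mathcal{H}_{\mathbb{R}}=\bigoplus_{k\ge1}\mathcal{H}(\mathbf{x}_k)_{\mathbb{R}}$. With the inner product of $\mathcal{H}$, which is real-valued on $\mathcal{H}_{\mathbb{R}}$, this is a real Hilbert space, and every $\mathbf{h}\in\mathcal{H}$ is uniquely $\mathbf{h}=\mathbf{h}_r+i\mathbf{h}_c$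 with $\mathbf{h}_r,\mathbf{h}_c\in\mathcal{H}_{\mathbb{R}}$. $\mathfrak{C}(\mathcal{H}_{\mathbb{R}})$ is the set of columns $\begin{bmatrix} \mathbf{h}_r \\ \mathbf{h}_c \end{bmatrix}$, $\mathbf{h}_r,\mathbf{h}_c\in\mathcal{H}_{\mathbb{R}}$, with componentwise addition, complex scalar multiplication $(s+it)\begin{bmatrix} \mathbf{h}_r \\ \mathbf{h}_c \end{bmatrix}=\begin{bmatrix} s\mathbf{h}_r-t\mathbf{h}_c \\ s\mathbf{h}_c+t\mathbf{h}_r \end{bmatrix}$, and inner product $\left\langle\begin{bmatrix} \mathbf{h}_r \\ \mathbf{h}_c \end{bmatrix},\begin{bmatrix} \mathbf{g}_r \\ \mathbf{g}_c \end{bmatrix}\right\rangle=\langle\mathbf{h}_r,\mathbf{g}_r\rangle+\langle\mathbf{h}_c,\mathbf{g}_c\rangle+i(\langle\mathbf{h}_c,\mathbf{g}_r\rangle-\langle\mathbf{h}_r,\mathbf{g}_c\rangle)$; it is a complex Hilbert space. Define the real linear map $Q_{\mathbb{R}}:\mathcal{H}\to\mathcal{H}_{\mathbb{R}}$ by $Q_{\mathbb{R}}(\mathbf{h}_r+i\mathbf{h}_c)=\mathbf{h}_r$ for $\mathbf{h}_r,\mathbf{h}_c\in\mathcal{H}_{\mathbb{R}}$, and $U_r,U_c:\mathcal{H}_{\mathbb{R}}\to\mathcal{H}_{\mathbb{R}}$ by $U_r\mathbf{h}=Q_{\mathbb{R}}U\mathbf{h}$ and $U_c\mathbf{h}=-Q_{\mathbb{R}}(iU\mathbf{h})$.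 A $2\times2$ matrix of real linear operators on $\mathcal{H}_{\mathbb{R}}$ acts on columns by the usual matrix multiplication. Operators $A$ on $\mathcal{H}$ and $B$ on $\mathcal{K}$ are unitarily equivalent if $TA=BT$ for some complex linear isometric isomorphism $T:\mathcal{H}\to\mathcal{K}$. *)

(* Defs.v *)
From HB Require Import structures.
From mathcomp Require Import all_boot all_order all_algebra.
From mathcomp Require Import complex.
From mathcomp Require Import all_classical all_reals all_analysis.

Set Implicit Arguments.
Unset Strict Implicit.
Unset Printing Implicit Defensive.

Import Order.TTheory GRing.Theory Num.Theory.
Import numFieldNormedType.Exports.

Local Open Scope classical_set_scope.
Local Open Scope complex_scope.
Local Open Scope ring_scope.

Section Circle.
Variable R : realType.

Definition circle : set R[i] := [set z | `|z| = 1].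

Definition borel_circle : set (set R[i]) :=
  <<s circle, [set circle `&` O | O in [set O : set (R[i] : numFieldType) | open O]] >>.

End Circle.
Arguments circle R : clear implicits.
Arguments borel_circle R : clear implicits.

Section Operators.
Variables (R : realType) (H : completeNormedModType R[i]).
(* [{dot H for Num.conj}] is linear in its first argument and conjugate-linear in
   its second one. *)
Variable dot : {dot H for Num.conj}.

Definition unitary (U : {linear H -> H}) : Prop :=
  exists V : {linear H -> H},
    [/\ forall h g, dot (U h) g = dot h (V g),
        forall h, U (V h) = h
      & forall h, V (U h) = h].

Definition orthogonal_projection (P : {linear H -> H}) : Prop :=
  (forall h, P (P h) = P h) /\ (forall h g, dot (P h) g = dot h (P g)).

(* Only the values of [E] on Borel subsets of the circle are constrained (and
   used). *)
Definition spectral_measure (E : set R[i] -> {linear H -> H}) : Prop :=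
  [/\ forall W, borel_circle R W -> orthogonal_projection (E W),
      (forall h, E set0 h = 0) /\ (forall h, E (circle R) h = h),
      forall W W', borel_circle R W -> borel_circle R W' ->
        forall h, E (W `&` W') h = E W (E W' h)
    & forall F : nat -> set R[i],
        (forall n, borel_circle R (F n)) -> trivIset setT F ->
        forall h, series (fun n => E (F n) h) @ \oo --> E (\bigcup_n F n) h].

(* [A] is the integral over the circle of the bounded Borel function [f] with
   respect to [E]: [A] is within [eps], in operator norm, of every sum
   \sum_k f(xi_k) E(D_k) over a finite Borel partition on the pieces of which
   [f] oscillates by less than [eps]. *)
Definition is_spectral_integral (E : set R[i] -> {linear H -> H})
    (f : R[i] -> R[i]) (A : H -> H) : Prop :=
  forall (eps : R) (n : nat) (D : 'I_n -> set R[i]) (xi : 'I_n -> R[i]),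
    0 < eps ->
    (forall k, borel_circle R (D k)) ->
    trivIset setT D ->
    \bigcup_k D k = circle R ->
    (forall k, D k (xi k)) ->
    (forall k z w, D k z -> D k w -> `|f z - f w| < eps%:C) ->
    forall h, `|A h - \sum_(k < n) f (xi k) *: E (D k) h| <= eps%:C * `|h|.

(* The closed linear span of [S] with coefficients taken in [K]; used with [K]
   either all of the complex numbers or the reals. *)
Definition closed_span (K : set R[i]) (S : set H) : set H :=
  closure [set h | exists (n : nat) (c : 'I_n -> R[i]) (s : 'I_n -> H),
    (forall i, K (c i) /\ S (s i)) /\ h = \sum_(i < n) c i *: s i].

Definition cyclic_space (E : set R[i] -> {linear H -> H}) (x : H) : set H :=
  closed_span setT [set E W x | W in borel_circle R].

Definition real_cyclic_space (E : set R[i] -> {linear H -> H}) (x : H) :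
    set H :=
  closed_span [set r%:C | r in [set: R]] [set E W x | W in borel_circle R].

(* A finite or infinite sequence is given by a length [N : option nat]
   ([None] for an infinite one) and a function on [nat], of which only the values
   at the indices [k] with [indexed N k] matter. *)
Definition indexed (N : option nat) (k : nat) : Prop :=
  if N is Some n then (k < n)%N else True.

Definition orthonormal_seq (N : option nat) (x : nat -> H) : Prop :=
  forall j k, indexed N j -> indexed N k -> dot (x j) (x k) = (j == k)%:R.

Definition sum_of_spaces (N : option nat) (F : nat -> set H) : set H :=
  [set h | exists u : nat -> H,
    [/\ forall k, indexed N k -> F k (u k),
        forall k, ~ indexed N k -> u k = 0
      & series u @ \oo --> h]].

Definition is_orthogonal_sum (N : option nat) (F : nat -> set H) : Prop :=
  (forall j k, indexed N j -> indexed N k -> j <> k ->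
     forall h g, F j h -> F k g -> dot h g = 0) /\
  sum_of_spaces N F = [set: H].

End Operators.

Section ClosedSubspaces.
Variables (R : realType) (H : completeNormedModType R[i]).

Lemma closure_ltP (A : set H) h :
  closure A h <-> forall e : R[i], 0 < e -> exists2 a, A a & `|h - a| < e.
Proof.
split=> [clA e e0|clA B].
  have [a [Aa Ba]] := clA _ (nbhsx_ballx h e e0).
  by exists a => //; move: Ba; rewrite -ball_normE.
move=> /nbhs_ballP[e /= e0 sB]; have [a Aa ha] := clA _ e0.
by exists a; split=> //; apply: sB; rewrite -ball_normE.
Qed.

Lemma real_span0 (S : set H) :
  closed_span [set r%:C | r in [set: R]] S 0.
Proof.
apply: subset_closure; exists 0%N, (fun=> 0), (fun=> 0).
by split=> [[]//|]; rewrite big_ord0.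
Qed.

Lemma real_spanP (S : set H) (r : R) h g :
  closed_span [set r%:C | r in [set: R]] S h ->
  closed_span [set r%:C | r in [set: R]] S g ->
  closed_span [set r%:C | r in [set: R]] S (r%:C *: h + g).
Proof.
move=> /closure_ltP ch /closure_ltP cg; apply/closure_ltP => e e0.
have r1 : 0 < `|r%:C| + 1 :> R[i] by rewrite ltr_wpDl.
have e2 : 0 < e / 2 by rewrite divr_gt0.
have [_ [n [c [s [cs ->]]]] dh] := ch _ (divr_gt0 e2 r1).
have [_ [m [d [t [dt ->]]]] dg] := cg _ e2.
exists (r%:C *: (\sum_(i < n) c i *: s i) + \sum_(i < m) d i *: t i).
  exists (n + m)%N,
    (fun i : 'I_(n + m) => match fintype.split i with inl j => r%:C * c j | inr j => d j end),
    (fun i : 'I_(n + m) => match fintype.split i with inl j => s j | inr j => t j end).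
  split=> [i|].
    case: (fintype.split i) => j; last exact: dt.
    have [[a _ ca] Ss] := cs j; split=> //.
    by exists (r * a) => //; rewrite -ca rmorphM.
  rewrite big_split_ord scaler_sumr; congr (_ + _); apply: eq_bigr => j _.
    by rewrite (unsplitK (inl j : 'I_n + 'I_m)) scalerA.
  by rewrite (unsplitK (inr j : 'I_n + 'I_m)).
rewrite opprD addrACA -scalerBr (le_lt_trans (ler_normD _ _))//.
rewrite [ltRHS](splitr e) ler_ltD// normrZ.
rewrite (@le_trans _ _ ((`|r%:C| + 1) * (e / 2 / (`|r%:C| + 1))))//.
  by rewrite ler_pM// ?ltW// ltrDl.
by rewrite mulrC divfK// gt_eqF.
Qed.

End ClosedSubspaces.

Section RealPart.
Variables (R : realType) (H : completeNormedModType R[i]).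
Variables (E : set R[i] -> {linear H -> H}) (N : option nat) (x : nat -> H).

(* The set of vectors of H_R; [real_part] below is the same set as a type. *)
Definition real_part_set : set H :=
  sum_of_spaces N (fun k => real_cyclic_space E (x k)).

Lemma real_part_set0 : real_part_set 0.
Proof.
exists (fun=> 0); split=> // [k _|]; first exact: real_span0.
rewrite (_ : series _ = (fun=> 0)); first exact: cvg_cst.
by apply/funext => n; rewrite /series/= big1.
Qed.

Lemma real_part_setP (r : R) h g :
  real_part_set h -> real_part_set g -> real_part_set (r%:C *: h + g).
Proof.
move=> [u [uF u0 uh]] [v [vF v0 vg]].
exists (fun k => r%:C *: u k + v k); split=> [k Nk|k Nk|].
- by apply: real_spanP; [exact: uF|exact: vF].
- by rewrite u0// v0// scaler0 addr0.
rewrite (_ : series _ = (fun n => r%:C *: series u n + series v n)).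
  by apply: cvgD => //; apply: cvgZr.
by apply/funext => n; rewrite /series/= big_split/= scaler_sumr.
Qed.

Definition real_part_pred : {pred H} := [pred h | `[< real_part_set h >]].

Fact real_part_zmod_closed : zmod_closed real_part_pred.
Proof.
split=> [|h g /asboolP hh /asboolP hg]; apply/asboolP.
  exact: real_part_set0.
rewrite -[h]scale1r addrC -scaleN1r.
have := real_part_setP (-1) hg hh.
by rewrite rmorphN1 scale1r.
Qed.

HB.instance Definition _ :=
  GRing.isZmodClosed.Build H real_part_pred real_part_zmod_closed.

Record real_part := RealPart {
  real_val :> H;
  real_valP : real_val \in real_part_pred }.

HB.instance Definition _ := [isSub for real_val].
HB.instance Definition _ := [Choice of real_part by <:].
HB.instance Definition _ := [SubChoice_isSubZmodule of real_part by <:].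

Fact real_part_scale_subproof (r : R) (h : real_part) :
  r%:C *: real_val h \in real_part_pred.
Proof.
have /asboolP hh := real_valP h; apply/asboolP.
by rewrite -[_ *: _]addr0; apply: real_part_setP => //; exact: real_part_set0.
Qed.

Definition real_part_scale (r : R) (h : real_part) : real_part :=
  RealPart (real_part_scale_subproof r h).

Fact real_part_scaleA a b h :
  real_part_scale a (real_part_scale b h) = real_part_scale (a * b) h.
Proof. by apply: val_inj; rewrite /= scalerA rmorphM. Qed.

Fact real_part_scale1 : left_id 1 real_part_scale.
Proof. by move=> h; apply: val_inj; rewrite /= scale1r. Qed.

Fact real_part_scaleDr : right_distributive real_part_scale +%R.
Proof. by move=> r h g; apply: val_inj; rewrite /= scalerDr. Qed.

Fact real_part_scaleDl h : {morph real_part_scale^~ h : a b / a + b}.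
Proof. by move=> a b; apply: val_inj; rewrite /= rmorphD scalerDl. Qed.

HB.instance Definition _ := GRing.Zmodule_isLmodule.Build R real_part
  real_part_scaleA real_part_scale1 real_part_scaleDr real_part_scaleDl.

End RealPart.

(* The columns with entries in a real vector space [V], top entry first. *)
Section Complexification.
Variables (R : realType) (V : lmodType R).

Definition complexification : Type := (V * V)%type.

HB.instance Definition _ := GRing.Zmodule.on complexification.

Definition complexification_scale (z : R[i]) (p : complexification) :
    complexification :=
  let: s +i* t := z in (s *: p.1 - t *: p.2, s *: p.2 + t *: p.1).

Fact complexification_scaleA a b p :
  complexification_scale a (complexification_scale b p) =
  complexification_scale (a * b) p.
Proof.
case: a b p => [s t] [s' t'] [h g]; congr pair => /=.
  rewrite scalerBr scalerDr !scalerA scalerBl scalerDl -!addrA; congr (_ + _).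
  by rewrite -!opprD addrA addrC.
rewrite scalerBr scalerDr !scalerA scalerBl scalerDl -!addrA; congr (_ + _).
by rewrite addrA addrC.
Qed.

Fact complexification_scale1 : left_id 1 complexification_scale.
Proof. by case=> h g; congr pair; rewrite /= scale1r scale0r ?subr0 ?addr0. Qed.

Fact complexification_scaleDr : right_distributive complexification_scale +%R.
Proof.
move=> [s t] [h g] [h' g']; congr pair => /=; rewrite !scalerDr.
  by rewrite opprD addrACA.
by rewrite addrACA.
Qed.

Fact complexification_scaleDl p :
  {morph complexification_scale^~ p : a b / a + b}.
Proof.
case: p => h g [s t] [s' t']; congr pair => /=; rewrite !scalerDl.
  by rewrite opprD addrACA.
by rewrite addrACA.
Qed.

HB.instance Definition _ := GRing.Zmodule_isLmodule.Build R[i] complexification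
  complexification_scaleA complexification_scale1
  complexification_scaleDr complexification_scaleDl.

(* The action on columns of the matrix of operators [a b; c d]. *)
Definition block_op (a b c d : V -> V) (p : complexification) :
    complexification :=
  (a p.1 + b p.2, c p.1 + d p.2).

Definition complexification_dot (ip : V -> V -> R[i])
    (p q : complexification) : R[i] :=
  ip p.1 q.1 + ip p.2 q.2 + 'i * (ip p.2 q.1 - ip p.1 q.2).

End Complexification.

Section RealOperators.
Variables (R : realType) (H : completeNormedModType R[i]).
Variable dot : {dot H for Num.conj}.
Variables (E : set R[i] -> {linear H -> H}) (N : option nat) (x : nat -> H).
Variable U : H -> H.

Local Notation HR := (real_part E N x).

Definition real_dot (h g : HR) : R[i] := dot (real_val h) (real_val g).

(* [QR h] is the [hr] of the decomposition h = hr + i hc with [hr], [hc] in H_R;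
   the default value 0 is not reached when E, x satisfy the conditions under
   which this decomposition exists and is unique. *)
Definition QR (h : H) : HR :=
  xget 0 [set hr | exists hc : HR, h = real_val hr + 'i *: real_val hc].

Definition Ur (h : HR) : HR := QR (U (real_val h)).

Definition Uc (h : HR) : HR := - QR ('i *: U (real_val h)).

Definition Uhat : complexification HR -> complexification HR :=
  block_op Ur (fun h => - Uc h) Uc Ur.

End RealOperators.

(* [dotH] and [dotK] are the inner products of [H] and [K]. *)
Definition unitarily_equivalent (R : realType) (H K : lmodType R[i])
    (dotH : H -> H -> R[i]) (dotK : K -> K -> R[i])
    (A : H -> H) (B : K -> K) : Prop :=
  exists T : {linear H -> K},
    [/\ bijective T,
        forall h g, dotK (T h) (T g) = dotH h g
      & forall h, T (A h) = B (T h)].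

(* Main.v *)
From HB Require Import structures.
Require Import Defs.
From mathcomp Require Import all_boot all_order all_algebra.
From mathcomp Require Import complex ring.
From mathcomp Require Import all_classical all_reals all_analysis.

Import Order.TTheory GRing.Theory Num.Theory.
Import numFieldNormedType.Exports.

Local Open Scope classical_set_scope.
Local Open Scope complex_scope.
Local Open Scope ring_scope.

(* Since E W and E W' are commuting self-adjoint projections,
    <E W y, E W' y> = <E W' y, E W y>; this symmetry passes to real linear
    combinations, to limits and to orthogonal sums, so the inner product is
    symmetric on H_R.  For p, q with <p, q> = <q, p> one has
    |p + i q|^2 = |p|^2 + |q|^2.  Hence real and imaginary parts of a Cauchy
    sequence are Cauchy, which gives H = H_R + i H_R by completeness, and the
    sum is direct.  The map h_r + i h_c |-> (h_r, h_c) is the required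
    equivalence. *)

Section DotComm.
Context {R : realType} {H : completeNormedModType R[i]}.
Variable dot : {dot H for Num.conj}.
Hypothesis dot_norm : forall h : H, dot h h = `|h| ^+ 2.

Local Notation real_coef := [set r%:C | r in [set: R]].

(** * Symmetry of the inner product: algebra, limits and real spans *)

Lemma conj_real_coef (c : R[i]) : real_coef c -> c^* = c.
Proof. by case=> r _ <-; apply/eqP; rewrite eq_complex /= oppr0 !eqxx. Qed.

Lemma complex_real_coef (c : R[i]) :
  exists a b, [/\ real_coef a, real_coef b & c = a + 'i * b].
Proof.
case: c => a b; exists a%:C, b%:C; split; [by exists a|by exists b|].
by rewrite -complexiE [LHS]complexE.
Qed.

(** The right-hand side is the formula of [complexification_dot], so this makes the passage to
    columns isometric. *)
Lemma dot_real_imag (a b c d : H) :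
  dot (a + 'i *: b) (c + 'i *: d) =
  dot a c + dot b d + 'i * (dot b c - dot a d).
Proof.
rewrite !linearDl !linearDr /= !linearZl_LR !linearZr_LR /=.
have -> : 'i^* *: ('i * dot b d) = dot b d.
  change ('i^* * ('i * dot b d) = dot b d).
  by rewrite conjCi mulrA mulNr -expr2 sqrCi opprK mul1r.
by rewrite conjCi; ring.
Qed.

(** Expanding [|p + iq|^2] shows that the expression on the right is [i (<q, p> - <p, q>)]. *)
Lemma dot_commE (p q : H) :
  dot p q = dot q p <-> `|p + 'i *: q| ^+ 2 - (`|p| ^+ 2 + `|q| ^+ 2) = 0.
Proof.
rewrite -!dot_norm dot_real_imag addrC addKr; split=> [->|/eqP].
  by rewrite subrr mulr0.
by rewrite mulf_eq0 (negbTE (neq0Ci _)) /= subr_eq0 => /eqP ->.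
Qed.

(** By Pythagoras, each of the two squares is bounded by their sum [|p + iq|^2]. *)
Lemma norm_le_normD_i (p q : H) : dot p q = dot q p ->
  `|p| <= `|p + 'i *: q| /\ `|q| <= `|p + 'i *: q|.
Proof.
move=> /dot_commE /eqP; rewrite subr_eq0 => /eqP e.
split; rewrite -(ler_pXn2r (n := 2)) ?nnegrE ?normr_ge0 // e.
  by rewrite lerDl exprn_ge0.
by rewrite lerDr exprn_ge0.
Qed.

(* By dot_commE, the symmetry is an equation between norms, so that the
   continuity of the inner product is not needed. *)
Lemma closed_dot_comm (g : H) : closed [set h | dot h g = dot g h].
Proof.
pose f (h : H) : R[i] := `|h + 'i *: g| ^+ 2 - (`|h| ^+ 2 + `|g| ^+ 2).
have -> : [set h | dot h g = dot g h] = f @^-1` [set 0].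
  by apply/seteqP; split=> h /dot_commE.
apply: closed_comp; last first.
  exact/accessible_closed_set1/hausdorff_accessible/norm_hausdorff.
move=> h _; rewrite /f; apply: cvgB.
  rewrite expr2; under eq_fun do rewrite expr2.
  by apply: cvgM; apply: cvg_norm; apply: cvgD;
    [exact: cvg_id|exact: cvg_cst|exact: cvg_id|exact: cvg_cst].
apply: cvgD; last exact: cvg_cst.
rewrite expr2; under eq_fun do rewrite expr2.
by apply: cvgM; apply: cvg_norm; exact: cvg_id.
Qed.

Lemma dot_comm_closure (A : set H) (g : H) :
  (forall h, A h -> dot h g = dot g h) ->
  forall h, closure A h -> dot h g = dot g h.
Proof.
move=> Ag h clh; suff : [set h | dot h g = dot g h] h by [].
by have /closure_id -> := closed_dot_comm g; apply: closureS clh.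
Qed.

Lemma dot_comm_sum I r (P : pred I) (F : I -> H) (g : H) :
  (forall i, P i -> dot (F i) g = dot g (F i)) ->
  dot (\sum_(i <- r | P i) F i) g = dot g (\sum_(i <- r | P i) F i).
Proof.
by move=> Fg; rewrite linear_sumlz linear_sumr; apply: eq_bigr.
Qed.

Lemma dot_comm_lim (u : nat -> H) (h g : H) :
  u @ \oo --> h -> (forall n, dot (u n) g = dot g (u n)) ->
  dot h g = dot g h.
Proof.
move=> uh ug.
by apply: (closed_cvg _ (closed_dot_comm g) _ _ uh); apply: nearW.
Qed.

(** Real coefficients equal their conjugates, so they leave both arguments of the form alike. The
    generators are replaced by elements of the span in one argument at a time. *)
Lemma dot_comm_real_span (S : set H) :
  (forall s t, S s -> S t -> dot s t = dot t s) ->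
  forall h g, closed_span real_coef S h -> closed_span real_coef S g ->
  dot h g = dot g h.
Proof.
have one_sided (g : H) : (forall s, S s -> dot s g = dot g s) ->
    forall h, closed_span real_coef S h -> dot h g = dot g h.
  move=> Sg; apply: dot_comm_closure => _ [n [c [s [cs ->]]]].
  apply: dot_comm_sum => i _; have [/conj_real_coef ci Ssi] := cs i.
  by rewrite linearZl_LR linearZr_LR /= ci (Sg _ Ssi).
move=> SS h g Sh Sg; apply: (one_sided g _ h Sh) => s Ss.
by rewrite (one_sided s _ g Sg) // => t St; exact: SS.
Qed.

(** * Separating real and imaginary parts in limits *)

(** The symmetry passes to the differences [p m - p n] and [q m - q n], so their norms are at most
    the distance between the combined terms; both sequences are Cauchy. *)
Lemma cvg_real_imag_parts (p q : nat -> H) (h : H) :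
  (forall m n, dot (p m) (q n) = dot (q n) (p m)) ->
  (fun n => p n + 'i *: q n) @ \oo --> h ->
  exists a b, [/\ p @ \oo --> a, q @ \oo --> b & h = a + 'i *: b].
Proof.
move=> pq zh.
have le_pq m n : `|p m - p n| <= `|(p m + 'i *: q m) - (p n + 'i *: q n)| /\
                 `|q m - q n| <= `|(p m + 'i *: q m) - (p n + 'i *: q n)|.
  rewrite opprD addrACA -scalerBr; apply: norm_le_normD_i.
  by rewrite !linearBl !linearBr /= !pq; ring.
have cvg_le (u : nat -> H) :
    (forall m n, `|u m - u n| <= `|(p m + 'i *: q m) - (p n + 'i *: q n)|) ->
    cvgn u.
  move=> le_u; apply/cauchy_cvgP/cauchy_exP => e e0.
  have e2 : 0 < e / 2 by rewrite divr_gt0.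
  have /cvgrPdist_lt /(_ _ e2) [m _ hm] := zh.
  exists (u m), m => // n /= mn; rewrite -ball_normE /=.
  apply: (le_lt_trans (le_u m n)).
  rewrite -(subrKA h) (splitr e) (le_lt_trans (ler_normD _ _)) // ltrD //.
    by rewrite distrC; apply: hm => /=.
  exact: hm.
have /cvg_ex[a pa] := cvg_le p (fun m n => proj1 (le_pq m n)).
have /cvg_ex[b qb] := cvg_le q (fun m n => proj2 (le_pq m n)).
exists a, b; split=> //; apply: (cvg_unique (@norm_hausdorff _ H) zh).
by apply: cvgD => //; apply: cvgZr.
Qed.

(** A finite complex combination splits by splitting its coefficients. Such combinations within
    [1/(n+1)] of [h] form a sequence whose two parts converge. *)
Lemma closed_span_real_imag (S : set H) :
  (forall s t, S s -> S t -> dot s t = dot t s) ->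
  forall h, closed_span setT S h ->
  exists a b, [/\ closed_span real_coef S a, closed_span real_coef S b
                & h = a + 'i *: b].
Proof.
move=> SS h /closure_ltP hS.
have /choice[z zP] (n : nat) : exists z : H * H,
    [/\ closed_span real_coef S z.1, closed_span real_coef S z.2
      & `|h - (z.1 + 'i *: z.2)| < n.+1%:R^-1].
  have [|_ [m [c [s [cs ->]]]] hz] := hS n.+1%:R^-1.
    by rewrite invr_gt0 ltr0n.
  have /choice[ab abP] (i : 'I_m) : exists ab : R[i] * R[i],
      [/\ real_coef ab.1, real_coef ab.2 & c i = ab.1 + 'i * ab.2].
    by have [a [b ?]] := complex_real_coef (c i); exists (a, b).
  exists (\sum_(i < m) (ab i).1 *: s i, \sum_(i < m) (ab i).2 *: s i).
  split=> /=.
  - apply: subset_closure; exists m, (fun i => (ab i).1), s; split=> // i.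
    by have [? ? _] := abP i; have [_ ?] := cs i.
  - apply: subset_closure; exists m, (fun i => (ab i).2), s; split=> // i.
    by have [? ? _] := abP i; have [_ ?] := cs i.
  - rewrite scaler_sumr -big_split /=; move: hz; congr (`|_ - _| < _).
    by apply: eq_bigr => i _; have [_ _ ->] := abP i; rewrite scalerDl scalerA.
have [||a [b [za zb hab]]] :=
  cvg_real_imag_parts (fun n => (z n).1) (fun n => (z n).2) h.
- move=> m n; have [z1 _ _] := zP m; have [_ z2 _] := zP n.
  exact: dot_comm_real_span z1 z2.
(* A positive element of [R[i]] has imaginary part 0, so the harmonic sequence in [R] suffices. *)
- apply/cvgrPdist_lt => -[r s] /[!ltcE] /= /andP[/eqP -> r0].
  have /cvgrPdist_lt /(_ _ r0) [m _ hm] := @cvg_harmonic R.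
  exists m => // n /= mn; have [_ _ /lt_le_trans] := zP n; apply.
  rewrite -(rmorph_nat (real_complex R)) -fmorphV lecR ltW //.
  by have := hm n mn; rewrite /= sub0r normrN ger0_norm ?harmonic_ge0.
exists a, b; split=> //.
- apply: (closed_cvg _ (@closed_closure _ _) _ _ za).
  by apply: nearW => n; case: (zP n).
- apply: (closed_cvg _ (@closed_closure _ _) _ _ zb).
  by apply: nearW => n; case: (zP n).
Qed.

(** * Symmetry of the inner product on [HR] *)

Variables (E : set R[i] -> {linear H -> H}) (N : option nat) (x : nat -> H).
Hypothesis E_spectral : spectral_measure dot E.
Hypothesis x_sum : is_orthogonal_sum dot N (fun k => cyclic_space E (x k)).

Local Notation HR := (real_part E N x).

(** Both sides equal [<y, E (W ∩ W') y>]. *)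
Lemma dot_comm_spectral (y s t : H) :
  [set E W y | W in borel_circle R] s -> [set E W y | W in borel_circle R] t ->
  dot s t = dot t s.
Proof.
have [projE _ EI _] := E_spectral.
move=> [W bW <-] [W' bW' <-]; have [_ aW] := projE W bW.
have [_ aW'] := projE W' bW'.
by rewrite aW -EI // setIC EI // -aW'.
Qed.

(** Carries the orthogonality given for the complex cyclic spaces over to the real ones. *)
Lemma real_cyclic_sub_cyclic (y : H) :
  real_cyclic_space E y `<=` cyclic_space E y.
Proof.
apply: closureS => _ [n [c [s [cs ->]]]]; exists n, c, s; split=> // i.
by have [_ ?] := cs i.
Qed.

(** The conditions of [sum_of_spaces] on the terms, without convergence: partial sums are treated
    before limits. *)
Definition real_terms (u : nat -> H) : Prop :=
  (forall k, indexed N k -> real_cyclic_space E (x k) (u k)) /\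
  (forall k, ~ indexed N k -> u k = 0).

(** Terms of equal index lie in the real span of one family [E W (x i)]; for distinct indices both
    products vanish by orthogonality. *)
Lemma dot_comm_series (u v : nat -> H) (m n : nat) :
  real_terms u -> real_terms v ->
  dot (series u m) (series v n) = dot (series v n) (series u m).
Proof.
move=> [uF u0] [vF v0]; apply: dot_comm_sum => i _; apply/esym.
apply: dot_comm_sum => j _.
have [Ni|/u0 ->] := pselect (indexed N i); last by rewrite linear0l linear0r.
have [Nj|/v0 ->] := pselect (indexed N j); last by rewrite linear0l linear0r.
have [eq_ij|neq_ij] := pselect (i = j).
  subst j; apply: dot_comm_real_span (vF _ Nj) (uF _ Ni).
  exact: dot_comm_spectral.
have cu := real_cyclic_sub_cyclic _ _ (uF _ Ni).
have cv := real_cyclic_sub_cyclic _ _ (vF _ Nj).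
have [orth _] := x_sum.
by rewrite (orth i j Ni Nj neq_ij _ _ cu cv)
  (orth j i Nj Ni (nesym neq_ij) _ _ cv cu).
Qed.

Lemma dot_comm_real_part (a b : HR) :
  dot (real_val a) (real_val b) = dot (real_val b) (real_val a).
Proof.
have /asboolP[u [uF u0 uh]] := real_valP a.
have /asboolP[v [vF v0 vg]] := real_valP b.
(* The limit is taken in the first argument; the equation is then reversed to take it in the
   other. *)
apply: dot_comm_lim uh _ => m; apply/esym; apply: dot_comm_lim vg _ => n.
by apply: dot_comm_series; split.
Qed.

(** * The decomposition [H = HR + i HR] and the map [QR] *)

(** Each term of a series for [h] is split in its own cyclic space; the partial sums of the two
    parts then converge. *)
Lemma real_part_decomp (h : H) :
  exists a b : HR, h = real_val a + 'i *: real_val b.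
Proof.
have [_ sumT] := x_sum.
have : sum_of_spaces N (fun k => cyclic_space E (x k)) h by rewrite sumT.
move=> [u [uF u0 uh]].
have /choice[ab abP] (k : nat) : exists ab : H * H,
    [/\ indexed N k -> real_cyclic_space E (x k) ab.1 /\
                       real_cyclic_space E (x k) ab.2,
        ~ indexed N k -> ab.1 = 0 /\ ab.2 = 0
      & u k = ab.1 + 'i *: ab.2].
  (* Off the index set both parts must be 0, as [sum_of_spaces] demands. *)
  have [Nk|Nk] := pselect (indexed N k); last first.
    by exists (0, 0); rewrite /= scaler0 addr0; split=> //; exact: u0.
  have [a [b [ca cb uab]]] :=
    closed_span_real_imag _ (dot_comm_spectral (x k)) _ (uF k Nk).
  by exists (a, b).
pose p k := (ab k).1; pose q k := (ab k).2.
have p_real : real_terms p.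
  by split=> k Nk; have [c0 n0 _] := abP k; [case: (c0 Nk)|case: (n0 Nk)].
have q_real : real_terms q.
  by split=> k Nk; have [c0 n0 _] := abP k; [case: (c0 Nk)|case: (n0 Nk)].
have [||a [b [pa qb hab]]] := cvg_real_imag_parts (series p) (series q) h.
- by move=> m n; exact: dot_comm_series.
- rewrite (_ : (fun n => _) = series u) //; apply/funext => n.
  rewrite /series /= scaler_sumr -big_split /=; apply: eq_bigr => k _.
  by have [_ _ ->] := abP k.
have a_in : a \in real_part_pred E N x.
  by apply/asboolP; exists p; case: p_real.
have b_in : b \in real_part_pred E N x.
  by apply/asboolP; exists q; case: q_real.
by exists (RealPart a_in), (RealPart b_in).
Qed.

(** Two decompositions differ by a vanishing [(a' - a) + i (b' - b)], whose norm bounds that of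
    [a' - a]. Uniqueness thus determines the value of [xget]. *)
Lemma QR_real_imag (a b : HR) : QR E N x (real_val a + 'i *: real_val b) = a.
Proof.
apply: xget_unique; first by exists b.
move=> a' [b' /eqP]; rewrite eq_sym -subr_eq0 opprD addrACA -scalerBr => /eqP e.
have : dot (real_val a' - real_val a) (real_val b' - real_val b) =
       dot (real_val b' - real_val b) (real_val a' - real_val a).
  rewrite !linearBl !linearBr /=.
  by rewrite !(dot_comm_real_part a') !(dot_comm_real_part a); ring.
move=> /norm_le_normD_i[+ _]; rewrite e normr0 normr_le0 subr_eq0 => /eqP.
exact: val_inj.
Qed.

Lemma QRD (h g : H) : QR E N x (h + g) = QR E N x h + QR E N x g.
Proof.
have [a [b ->]] := real_part_decomp h; have [c [d ->]] := real_part_decomp g.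
rewrite addrACA -scalerDr !QR_real_imag.
exact: (QR_real_imag (a + c) (b + d)).
Qed.

Lemma QRN (h : H) : QR E N x (- h) = - QR E N x h.
Proof.
have [a [b ->]] := real_part_decomp h.
by rewrite opprD -scalerN QR_real_imag; exact: (QR_real_imag (- a) (- b)).
Qed.

End DotComm.

Theorem theorem6p6 (R : realType) (H : completeNormedModType R[i])
    (dot : {dot H for Num.conj})
    (dot_norm : forall h : H, dot h h = `|h| ^+ 2)
    (H_separable : exists2 D : set H, countable D & dense D)
    (U : {linear H -> H}) (U_unitary : unitary dot U)
    (E : set R[i] -> {linear H -> H}) (E_spectral : spectral_measure dot E)
    (U_int : is_spectral_integral E (fun xi => xi) U)
    (N : option nat) (x : nat -> H) (x_orthonormal : orthonormal_seq dot N x)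
    (x_sum : is_orthogonal_sum dot N (fun k => cyclic_space E (x k))) :
  unitarily_equivalent dot
    (complexification_dot (@real_dot R H dot E N x))
    U (Uhat (E := E) (N := N) (x := x) U).
Proof.
have decomp := real_part_decomp dot dot_norm E N x E_spectral x_sum.
have QRri := QR_real_imag dot dot_norm E N x E_spectral x_sum.
have QR_D := QRD dot dot_norm E N x E_spectral x_sum.
(* Since [-i (a + ib) = b - ia], the imaginary part of [h] is [QR] of [-i h]. *)
pose T (h : H) : complexification (real_part E N x) :=
  (QR E N x h, QR E N x (- 'i *: h)).
have Tri (a b : real_part E N x) : T (real_val a + 'i *: real_val b) = (a, b).
  congr pair; first exact: QRri.
  rewrite scalerDr scalerA mulNr -expr2 sqrCi opprK scale1r addrC.
  rewrite scaleNr -scalerN.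
  exact: (QRri b (- a)).
have T_lin : linear T.
  move=> [s t] h g; have [a [b ->]] := decomp h; have [c [d ->]] := decomp g.
  rewrite !Tri.
  (* Multiplying out [(s + it)(a + ib)] yields the entries of the scalar action on columns. *)
  have -> : (s +i* t) *: (real_val a + 'i *: real_val b) +
      (real_val c + 'i *: real_val d) =
    real_val (s *: a - t *: b + c) + 'i *: real_val (s *: b + t *: a + d).
    rewrite [s +i* t]complexE /= complexiE scalerDl !scalerDr !scalerA.
    rewrite mulrAC -expr2 sqrCi mulN1r scaleNr [s%:C * 'i]mulrC.
    by rewrite [('i * t%:C) *: _ + _]addrC (addrACA (s%:C *: _)) [LHS]addrACA.
  by rewrite Tri.
pose TL := GRing.isLinear.Build R[i] H (complexification (real_part E N x))
  *:%R T T_lin.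
pose TT : {linear H -> complexification (real_part E N x)} := HB.pack T TL.
have TTE h : TT h = (QR E N x h, QR E N x (- 'i *: h)) by [].
exists TT; split.
- exists (fun p => real_val p.1 + 'i *: real_val p.2) => [h|[a b]].
    by have [a [b ->]] := decomp h; rewrite [TT _]Tri.
  exact: Tri.
- move=> h g; have [a [b ->]] := decomp h; have [c [d ->]] := decomp g.
  rewrite ![TT _]Tri /complexification_dot /real_dot /=.
  by rewrite dot_real_imag.
(* With [U (a + ib) = Ua + i Ub], the top entry is [QR (Ua) + QR (i Ub) = Ur a - Uc b], and the
   bottom one is [QR (-i Ua) + QR (Ub) = Uc a + Ur b]. *)
- move=> h; have [a [b ->]] := decomp h.
  rewrite [TT (_ + _)]Tri /Uhat /block_op /Ur /Uc /= !opprK.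
  rewrite [LHS]TTE linearD linearZ /= QR_D; congr pair.
  rewrite scalerDr scaleNr scalerA mulNr -expr2 sqrCi opprK scale1r QR_D.
  by rewrite (QRN dot dot_norm E N x E_spectral x_sum).
Qed.
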